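(* Let $b_1,\dots,b_k$ be nonnegative integers, $n_1,\dots,n_k$ integers, and $n$ a positive integer, and suppose $\sum_{i=1}^kn_ib_i^m=0$ for $m=1,3,5,\dots,2n-1$. Then for all sufficiently large primes $p$, $$\prod_{i=1}^k(b_ip)!^{n_i}\equiv\prod_{i=1}^kb_i!^{n_i}\pmod{p^{2n+1}}.$$
   Context: The congruence is between $p$-adic integers (units for large $p$), i.e. the difference lies in $p^{2n+1}\mathbb Z_p$. *)

(* Defs.v *)
From HB Require Import structures.
From mathcomp Require Import all_boot all_order all_algebra.
Set Implicit Arguments. Unset Strict Implicit. Unset Printing Implicit Defensive.
Import Order.TTheory GRing.Theory Num.Theory.
Local Open Scope ring_scope.

(* [padic_congr p e x y] : the rationals x and y are congruent modulo p^e
   in Z_p, i.e. x - y lies in p^e Z_p.  For rationals, Z_p ∩ Q = Z_(p),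
   so this means x - y = p^e * (u / v) with u, v integers and p ∤ v. *)
Definition padic_congr (p e : nat) (x y : rat) : Prop :=
  exists (u v : int), ~~ (p%:Z %| v)%Z /\ x - y = (p ^ e)%:R * (u%:~R / v%:~R).

(* Main.v *)
Require Import Defs.
From HB Require Import structures.
From mathcomp Require Import all_boot all_order all_algebra all_field.
From mathcomp Require Import ring zify.
Set Implicit Arguments.
Unset Strict Implicit.
Unset Printing Implicit Defensive.
Import Order.TTheory GRing.Theory Num.Theory.
Local Open Scope ring_scope.

(* Write (bp)! = (-p)^b b! W(b), where W(b) is the product of F(a) = - prod_(0 < j < p) (ap + j)
   over a < b.  For p odd F(-1 - a) = F(a), so W extends to an odd map from the integers to the
   multiplicative group (W(-b) = 1 / W(b)), with multiplicative difference F.  Modulo p,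
   prod_(0 < j < p) (X + j) is X^(p-1) - 1, so the i-th difference of F - 1 is divisible by
   p^(i+1) for i <= 2n < p - 1, and hence the (2n)-th multiplicative difference of F is 1 modulo p^(2n+1).  Thus,
   modulo p^(2n+1) and up to an exponent prime to p, W is the exponential of an odd polynomial
   of degree at most 2n, and the product of the W(b_i)^(n_i) is killed by the hypotheses on the
   odd moments of the n_i. *)

(** * Finite differences and falling factorials *)

Lemma exprz_sumr (K : fieldType) (I : finType) (c : K) (m : I -> int) :
  c != 0 -> c ^ (\sum_i m i) = \prod_i c ^ m i.
Proof.
move=> c0.
exact: (big_morph (exprz c) (fun x y => expfzDr x y c0) (expr0z c)).
Qed.

Definition diff (R : zmodType) (f : int -> R) (z : int) : R := f (z + 1) - f z.
Arguments diff {R} f z.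

Lemma eq_iter_diff (R : zmodType) (f g : int -> R) k :
  f =1 g -> iter k diff f =1 iter k diff g.
Proof. by move=> fg; elim: k => [|k IH] //= z; rewrite /diff !IH. Qed.

Lemma iter_diffMl (R : pzRingType) (a : R) (f : int -> R) k z :
  iter k diff (fun x => a * f x) z = a * iter k diff f z.
Proof. by elim: k z => [|k IH] //= z; rewrite /diff !IH mulrBr. Qed.

Definition ffactz (k : nat) (z : int) : int := \prod_(i < k) (z - i%:Z).

Lemma diff_ffactz k z : diff (ffactz k.+1) z = k.+1%:Z * ffactz k z.
Proof.
rewrite /diff /ffactz big_ord_recl big_ord_recr /=.
rewrite (eq_bigr (fun i : 'I_k => z - i%:Z)); last first.
  by move=> i _; rewrite /= /bump leq0n add1n intS; ring.
by rewrite intS; ring.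
Qed.

Lemma iter_diff_ffactz k z : iter k diff (ffactz k) z = k`!%:Z.
Proof.
elim: k z => [|k IH] z; first by rewrite /= /ffactz big_ord0.
rewrite iterSr (eq_iter_diff _ (diff_ffactz k)) iter_diffMl IH factS.
by rewrite PoszM.
Qed.

(** * Multiplicative differences modulo a multiplicative group *)

Section MultiplicativeDifference.
Variable K : fieldType.
Implicit Types f : int -> K.

Definition mdiff f (z : int) : K := f (z + 1) / f z.

Lemma eq_iter_mdiff f g k : f =1 g -> iter k mdiff f =1 iter k mdiff g.
Proof. by move=> fg; elim: k => [|k IH] //= z; rewrite /mdiff !IH. Qed.

Lemma iter_mdiffX f (q : int -> int) (c : K) m k z : c != 0 ->
  iter k mdiff (fun x => f x ^+ m / c ^ q x) z
    = iter k mdiff f z ^+ m / c ^ iter k diff q z.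
Proof.
move=> c0; elim: k z => [|k IH] //= z.
rewrite /mdiff /diff !IH expfzDr // -invr_expz expr_div_n !invfM !invrK.
by ring.
Qed.

Variable H : {pred K}.
Hypothesis divH : divr_closed H.

Let H1 : 1 \in H. Proof. by case: divH. Qed.
Let Hdiv x y : x \in H -> y \in H -> x / y \in H. Proof. by case: divH => _; apply. Qed.
Let HV x : x \in H -> x^-1 \in H. Proof. by move=> Hx; rewrite -[x^-1]mul1r Hdiv. Qed.
Let HM x y : x \in H -> y \in H -> x * y \in H.
Proof. by move=> Hx Hy; rewrite -[y]invrK Hdiv ?HV. Qed.

Lemma divr_closed_exp x m : x \in H -> x ^+ m \in H.
Proof. by move=> Hx; elim: m => [|m IH]; rewrite ?exprS ?HM. Qed.

Lemma divr_closed_expz x (m : int) : x \in H -> x ^ m \in H.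
Proof.
move=> Hx; case: m => m; first exact: divr_closed_exp.
by rewrite NegzE -invr_expz HV // divr_closed_exp.
Qed.

Lemma divr_closed_prod (I : Type) (r : seq I) (P : pred I) (f : I -> K) :
  (forall i, P i -> f i \in H) -> \prod_(i <- r | P i) f i \in H.
Proof. by move=> Hf; elim/big_ind: _. Qed.

(** The quotient telescopes into values of [mdiff f], going up from 0 for positive [z] and down for
    negative [z]. *)
Lemma mdiff_closed f :
  (forall z, f z != 0) -> (forall z, mdiff f z \in H) -> forall z, f z / f 0 \in H.
Proof.
move=> f0 Hf; elim/int_rect => [|m IH|m IH]; first by rewrite divff.
  have := HM (Hf m) IH; rewrite /mdiff mulrA mulfVK //.
  by rewrite -addn1 PoszD.
have := Hdiv IH (Hf (- m.+1%:Z)); rewrite /mdiff.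
have -> : - m.+1%:Z + 1 = - m%:Z by rewrite intS opprD addrAC addNr add0r.
by rewrite invf_div mulrC -mulrA mulKf.
Qed.

(* A function with [k]-th multiplicative difference in [H] is, modulo [H] and after
   raising to the power [\prod_(j < k) j`!], of the form [z |-> c_0 ^ q_0(z) * c_1 ^ q_1(z) * ...]
   for polynomials [q_i] of degree less than [k]. *)
Lemma prod_exprz_closed (I : finType) (z w : I -> int) k f :
    (forall x, f x != 0) -> (forall x, iter k mdiff f x \in H) ->
    (forall q : {poly int}, (size q <= k)%N -> \sum_i w i * q.[z i] = 0) ->
  (\prod_i f (z i) ^ w i) ^+ (\prod_(j < k) j`!) \in H.
Proof.
elim: k f => [|k IH] f f0 Hf wq.
  by rewrite big_ord0 expr1; apply: divr_closed_prod => i _; apply/divr_closed_expz/Hf.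
have g0 j x : iter j mdiff f x != 0.
  by elim: j x => [|j IHj] //= x; rewrite mulf_neq0 ?invr_neq0.
set c := iter k mdiff f 0.
(* Modulo [H] the [k]-th multiplicative difference of [f] is the constant [c]. Since the [k]-th
   difference of [ffactz k] is [k!], this quotient cancels that leading term without taking roots of
   [c]. *)
pose h x := f x ^+ k`! / c ^ ffactz k x.
have h0 x : h x != 0 by rewrite mulf_neq0 ?invr_neq0 ?expf_neq0 ?expfz_neq0 // g0.
have Hh x : iter k mdiff h x \in H.
  rewrite iter_mdiffX ?g0 // iter_diff_ffactz -exprnP -expr_div_n divr_closed_exp //.
  by apply: mdiff_closed; [exact: g0 | exact: Hf].
have := IH h h0 Hh (fun q sq => wq q (leqW sq)).
rewrite big_ord_recr /= mulnC exprM.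
suff -> : \prod_i h (z i) ^ w i = (\prod_i f (z i) ^ w i) ^+ k`! by [].
pose q : {poly int} := \prod_(i < k) ('X - (i%:Z)%:P).
have qE x : q.[x] = ffactz k x.
  by rewrite horner_prod; apply: eq_bigr => i _; rewrite hornerXsubC.
(* The weights annihilate the degree [k] polynomial [ffactz k], so the powers of [c] disappear from
   the weighted product. *)
have wq0 : \sum_i ffactz k (z i) * w i = 0.
  rewrite -[RHS](wq q); last by rewrite size_prod_XsubC /index_enum -enumT size_enum_ord.
  by apply: eq_bigr => i _; rewrite qE mulrC.
rewrite -prodrXl.
transitivity (\prod_i ((f (z i) ^ w i) ^+ k`! / c ^ (ffactz k (z i) * w i))).
  apply: eq_bigr => i _.
  by rewrite /h expfzMl -expfV exprz_exp !exprnP exprzAC.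
by rewrite big_split /= prodfV -exprz_sumr ?g0 // wq0 invr1 mulr1.
Qed.

End MultiplicativeDifference.

Arguments mdiff {K} f z.

(** * The [pi]-adic filtration and flat functions *)

Section AdicFiltration.
Variables (K : fieldType) (V : subringClosed K) (pi : K).
Implicit Types (f g : int -> K) (x y : K).

Definition adic (j : nat) : {pred K} := [pred x | x / pi ^+ j \in V].

Hypotheses (pi_neq0 : pi != 0) (piV : pi \in V).
(** This says that [pi] lies in the Jacobson radical of [V]. *)
Hypothesis pi_rad : forall x, x \in V -> 1 + pi * x != 0 /\ (1 + pi * x)^-1 \in V.

Lemma adicP j x : reflect (exists2 y, y \in V & x = pi ^+ j * y) (x \in adic j).
Proof.
apply: (iffP idP) => [Vx|[y Vy ->]].
  by exists (x / pi ^+ j); rewrite // mulrC mulfVK ?expf_neq0.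
by rewrite inE mulrAC mulfV ?expf_neq0 // mul1r.
Qed.

Lemma adic_zmod_closed j : zmod_closed (adic j).
Proof.
split=> [|x y]; first by rewrite inE mul0r rpred0.
by rewrite !inE mulrBl; apply: rpredB.
Qed.

HB.instance Definition _ j := GRing.isZmodClosed.Build K (adic j) (adic_zmod_closed j).

Lemma adicM i j x y : x \in adic i -> y \in adic j -> x * y \in adic (i + j).
Proof. by rewrite !inE exprD invfM mulrACA; apply: rpredM. Qed.

Lemma adic0 x : (x \in adic 0) = (x \in V).
Proof. by rewrite inE divr1. Qed.

Lemma adicMl j x y : x \in V -> y \in adic j -> x * y \in adic j.
Proof. by rewrite -adic0; apply: adicM. Qed.

Lemma adicMr j x y : x \in adic j -> y \in V -> x * y \in adic j.
Proof. by move=> xj Vy; rewrite mulrC adicMl. Qed.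

Lemma leq_adic i j x : (i <= j)%N -> x \in adic j -> x \in adic i.
Proof.
move=> ij /adicP[y Vy ->]; apply/adicP; exists (pi ^+ (j - i) * y).
  by rewrite rpredM ?rpredX.
by rewrite mulrA -exprD subnKC.
Qed.

Lemma adic1_unit x : x - 1 \in adic 1 -> x != 0 /\ x^-1 \in V.
Proof.
move=> /adicP[y Vy]; rewrite expr1 => xE.
by rewrite -[x](subrKC 1) xE; apply: pi_rad.
Qed.

Definition one_adic (j : nat) : {pred K} := [pred x | x - 1 \in adic j].

Lemma one_adic_divr_closed j : divr_closed (one_adic j.+1).
Proof.
split=> [|x y xj yj]; first by rewrite inE /= subrr rpred0.
have [y0 Vy] := adic1_unit (leq_adic (ltn0Sn j) yj).
rewrite inE /=; have -> : x / y - 1 = (x - 1 - (y - 1)) * y^-1.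
  by rewrite opprB addrA subrK mulrBl divff.
by apply: adicMr => //; apply: rpredB.
Qed.

(** Factor [x ^+ m - 1] as [(x - 1) * s]. As [x] is 1 modulo [pi], [s] is congruent to the unit [m],
    hence is itself a unit. *)
Lemma one_adicX_inj m j x : (m%:R)^-1 \in V -> m%:R != 0 :> K ->
  x \in one_adic 1 -> x ^+ m \in one_adic j -> x \in one_adic j.
Proof.
move=> Vm m0 x1 xm; set s := \sum_(i < m) x ^+ i.
have sm : s / m%:R - 1 \in adic 1.
  have -> : s / m%:R - 1 = (\sum_(i < m) (x ^+ i - 1)) / m%:R.
    rewrite big_split /= sumrN sumr_const card_ord mulrBl divff //.
  rewrite adicMr // rpred_sum // => i _.
  exact: (divr_closed_exp (one_adic_divr_closed 0) i x1).
have [s0 Vs] := adic1_unit sm.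
have -> : x \in one_adic j = (x - 1 \in adic j) by [].
have s_neq0 : s != 0 by apply: contraNneq s0 => ->; rewrite mul0r.
have -> : x - 1 = (x ^+ m - 1) * ((s / m%:R)^-1 / m%:R).
  by rewrite subrX1 -/s invf_div; field; rewrite m0.
by rewrite adicMr // rpredM.
Qed.

(* [flat m j f]: the [i]-th difference of [f] lies in [pi ^ (i + j) V], for [i <= m]. *)
Fixpoint flat (m j : nat) (f : int -> K) : Prop :=
  (forall z, f z \in adic j) /\ (if m is m'.+1 then flat m' j.+1 (diff f) else True).

Lemma flat_adic m j f : flat m j f -> forall z, f z \in adic j.
Proof. by case: m => [|m] []. Qed.

Lemma eq_flat m j f g : f =1 g -> flat m j f -> flat m j g.
Proof.
elim: m j f g => [|m IH] j f g fg [Hf Hd]; (split=> [z|//]; first by rewrite -fg).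
by apply: IH Hd => z; rewrite /diff !fg.
Qed.

Lemma flatW m j f : flat m.+1 j f -> flat m j f.
Proof.
elim: m j f => [|m IH] j f [Hf Hd]; first by split.
by split=> //; apply: IH.
Qed.

Lemma leq_flat m i j f : (i <= j)%N -> flat m j f -> flat m i f.
Proof.
elim: m i j f => [|m IH] i j f ij [Hf Hd];
  (split=> [z|//]; first exact: leq_adic (Hf z)).
exact: IH Hd.
Qed.

Lemma flat_shift m j f : flat m j f -> flat m j (fun z => f (z + 1)).
Proof.
elim: m j f => [|m IH] j f [Hf Hd]; (split=> [z|//]; first exact: Hf).
exact: (IH _ _ Hd).
Qed.

Lemma flatD m j f g : flat m j f -> flat m j g -> flat m j (fun z => f z + g z).
Proof.
elim: m j f g => [|m IH] j f g [Hf Hdf] [Hg Hdg];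
  (split=> [z|//]; first exact: rpredD).
by apply: eq_flat (IH _ _ _ Hdf Hdg) => z; rewrite /diff; ring.
Qed.

(** Discrete Leibniz rule: the difference of [f * g] at [z] is
    [diff f z * g z + f (z + 1) * diff g z], and each term gains one power of [pi]. *)
Lemma flatM m i j f g : flat m i f -> flat m j g -> flat m (i + j) (fun z => f z * g z).
Proof.
elim: m i j f g => [|m IH] i j f g Hf Hg.
  by split=> // z; apply: adicM; [apply: flat_adic Hf _ | apply: flat_adic Hg _].
split=> [z|]; first by apply: adicM; [apply: flat_adic Hf _ | apply: flat_adic Hg _].
have := IH _ _ _ _ Hf.2 (flatW Hg).
have := IH _ _ _ _ (flat_shift (flatW Hf)) Hg.2.
rewrite addnS addSn => H1 H2.
by apply: eq_flat (flatD H2 H1) => z; rewrite /diff; ring.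
Qed.

Lemma flat_cst m j c : c \in adic j -> flat m j (fun=> c).
Proof.
elim: m j c => [|m IH] j c Hc; (split=> [z|//]; first exact: Hc).
by apply: eq_flat (IH _ 0 (rpred0 _)) => z; rewrite /diff subrr.
Qed.

(** All differences of [f] are integers, and [c] already carries the largest power of [pi]
    required. *)
Lemma flat_int m j (f : int -> int) (c : K) :
  c \in adic (m + j) -> flat m j (fun z => (f z)%:~R * c).
Proof.
elim: m j f => [|m IH] j f Hc.
  by split=> // z; rewrite adicMl ?rpred_int.
split=> [z|]; first by rewrite adicMl ?rpred_int // (leq_adic _ Hc) // leq_addl.
rewrite addSnnS in Hc; apply: eq_flat (IH _ (diff f) Hc) => z.
by rewrite /diff rmorphB mulrBl.
Qed.

(** The map [z |-> pi * z] has constant difference [pi], so it is flat; Horner's scheme then builds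
    [q] from it by sums and products. *)
Lemma flat_horner m (q : {poly K}) :
  q \is a polyOver V -> flat m 0 (fun z => q.[pi * z%:~R]).
Proof.
move=> Vq; elim/poly_ind: q Vq => [|q c IH] Vq.
  by apply: eq_flat (flat_cst m (rpred0 _)) => z; rewrite horner0.
have Vc : c \in V.
  by have /polyOverP/(_ 0) := Vq; rewrite coefD coefMX coefC add0r.
have Vq' : q \is a polyOver V.
  apply/polyOverP => i; have /polyOverP/(_ i.+1) := Vq.
  by rewrite coefD coefMX coefC addr0.
have Hid : flat m 0 (fun z => pi * z%:~R).
  case: m {IH} => [|m]; 
    (split=> [z|//]; first by rewrite adic0 rpredM ?rpred_int).
  apply: (@eq_flat _ _ (fun=> pi)); last first.
    by apply: flat_cst; apply/adicP; exists 1; rewrite ?rpred1 ?mulr1 ?expr1.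
  by move=> z; rewrite /diff intrD mulrDr mulr1 addrAC subrr add0r.
apply: eq_flat (flatD (flatM (IH Vq') Hid) (flat_cst m (_ : c \in adic 0))) => [z|].
  by rewrite hornerMXaddC.
by rewrite adic0.
Qed.

(** The difference of [1 / f] is [- diff f z / (f z * f (z + 1))], whose inverses need one order of
    flatness less, so induction on [m] applies. *)
Lemma flatV m f : flat m 0 f -> (forall z, f z != 0) -> (forall z, (f z)^-1 \in V) ->
  flat m 0 (fun z => (f z)^-1).
Proof.
move=> + f0 Vf; elim: m => [|m IH] Hf; first by split=> // z; rewrite adic0.
split=> [z|]; first by rewrite adic0.
have Hi := IH (flatW Hf).
have := flatM (flatM Hf.2 Hi) (flat_shift Hi); rewrite !addn0.
move=> /(flatM (flat_cst m (_ : -1 \in adic 0))) H.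
apply: eq_flat (H _) => [z|]; last by rewrite adic0 rpredN rpred1.
by rewrite /diff; field; rewrite f0 f0.
Qed.

(** As [mdiff f z - 1 = diff f z / f z], one order of flatness is traded for one more power of
    [pi]. *)
Lemma flat_mdiff m j f : flat m.+1 j.+1 (fun z => f z - 1) ->
  flat m j.+2 (fun z => mdiff f z - 1).
Proof.
move=> Hf; have Hf1 z := adic1_unit (leq_adic (ltn0Sn j) (flat_adic Hf z)).
have f0 z := (Hf1 z).1; have Vf z := (Hf1 z).2.
have Ff : flat m 0 f.
  have F1 : flat m 0 (fun=> 1) by apply: flat_cst; rewrite adic0 rpred1.
  by apply: eq_flat (flatD (leq_flat (leq0n _) (flatW Hf)) F1) => z; rewrite subrK.
have := flatM Hf.2 (flatV Ff f0 Vf); rewrite addn0.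
by apply: eq_flat => z; rewrite /diff /mdiff; field.
Qed.

Lemma iter_mdiff_one_adic m j f : flat m j.+1 (fun z => f z - 1) ->
  forall z, iter m mdiff f z \in one_adic (m + j).+1.
Proof.
elim: m j f => [|m IH] j f Hf z; first exact: flat_adic Hf z.
by rewrite iterSr addSnnS; apply: IH; apply: flat_mdiff.
Qed.

End AdicFiltration.

(** * The localization of the integers at [p] *)

(* Primality is an argument so that the closure instance below can be inferred
   from the predicate alone. *)
Definition Zloc (p : nat) (p_pr : prime p) : {pred rat} := [pred x | ~~ (p%:Z %| denq x)%Z].

Section Localization.
Variables (p : nat) (p_pr : prime p).

Lemma ZlocP x : reflect (exists u v : int, ~~ (p%:Z %| v)%Z /\ x = u%:~R / v%:~R)
  (x \in Zloc p_pr).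
Proof.
apply: (iffP idP) => [px|[u [v [pv xE]]]].
  by exists (numq x), (denq x); split; rewrite ?divq_num_den.
have v0 : v%:~R != 0 :> rat by rewrite intr_eq0; apply: contraNneq pv => ->; rewrite dvdz0.
rewrite inE; apply: contra pv => /dvdz_trans; apply.
(* The reduced denominator divides every denominator, being coprime to the numerator. *)
have : (denq x %| numq x * v)%Z.
  apply/dvdzP; exists u; apply: (@intr_inj rat).
  rewrite !rmorphM /= -[X in X * _ = _](mulfVK (_ : (denq x)%:~R != 0)) ?intr_eq0 ?denq_neq0 //.
  by rewrite divq_num_den mulrAC [X in X * _ * _]xE mulfVK.
by rewrite Gauss_dvdzr // coprimez_sym /coprimez /gcdz; have := coprime_num_den x.
Qed.

Lemma Zloc_subring_closed : subring_closed (Zloc p_pr).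
Proof.
have nM u v : ~~ (p%:Z %| u)%Z -> ~~ (p%:Z %| v)%Z -> ~~ (p%:Z %| u * v)%Z.
  by rewrite !dvdzE abszM Euclid_dvdM // => pu pv; rewrite negb_or pu.
have n0 v : ~~ (p%:Z %| v)%Z -> v%:~R != 0 :> rat.
  by move=> pv; rewrite intr_eq0; apply: contraNneq pv => ->; rewrite dvdz0.
split=> [|x y|x y].
- apply/ZlocP; exists 1, 1; split; last by rewrite divr1.
  by rewrite dvdzE /= dvdn1 neq_ltn prime_gt1 ?orbT.
- move=> /ZlocP[u [v [pv ->]]] /ZlocP[u' [v' [pv' ->]]].
  apply/ZlocP; exists (u * v' - u' * v), (v * v'); split; first exact: nM.
  by rewrite rmorphB !rmorphM /=; field; rewrite !n0.
- move=> /ZlocP[u [v [pv ->]]] /ZlocP[u' [v' [pv' ->]]].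
  apply/ZlocP; exists (u * u'), (v * v'); split; first exact: nM.
  by rewrite !rmorphM /=; field; rewrite !n0.
Qed.

HB.instance Definition _ :=
  GRing.isSubringClosed.Build rat (Zloc p_pr) Zloc_subring_closed.

Lemma Zloc_rad x : x \in Zloc p_pr ->
  1 + p%:R * x != 0 /\ (1 + p%:R * x)^-1 \in Zloc p_pr.
Proof.
move=> /ZlocP[u [v [pv ->]]].
have v0 : v%:~R != 0 :> rat.
  by rewrite intr_eq0; apply: contraNneq pv => ->; rewrite dvdz0.
have pw : ~~ (p%:Z %| v + p%:Z * u)%Z by rewrite rpredDr // dvdz_mulr.
have w0 : (v + p%:Z * u)%:~R != 0 :> rat.
  by rewrite intr_eq0; apply: contraNneq pw => ->; rewrite dvdz0.
have -> : 1 + p%:R * (u%:~R / v%:~R) = (v + p%:Z * u)%:~R / v%:~R :> rat.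
  by rewrite rmorphD rmorphM /=; field.
split; first by rewrite mulf_neq0 ?invr_neq0.
by apply/ZlocP; exists v, (v + p%:Z * u); split; rewrite ?invf_div.
Qed.

Lemma Zloc_natV m : ~~ (p %| m)%N -> (m%:R)^-1 \in Zloc p_pr.
Proof. by move=> pm; apply/ZlocP; exists 1, m; rewrite div1r. Qed.

Lemma prime_neq0_rat : p%:R != 0 :> rat.
Proof. by rewrite pnatr_eq0 -lt0n prime_gt0. Qed.

End Localization.

(** * The product of the [X + j] modulo [p] *)

(** This is the factorization of [X^p - X] over the field with [p] elements, with roots reindexed by
    negation and the factor [X] cancelled. *)
Lemma map_prod_XaddC_Fp p : prime p ->
  \prod_(1 <= j < p) ('X + (j%:R)%:P) = 'X^(p.-1) - 1 :> {poly 'F_p}.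
Proof.
move=> p_pr; apply: (mulfI (negbT (polyX_eq0 _))).
have := finField_genPoly 'F_p; rewrite card_Fp //.
rewrite (reindex_inj (@oppr_inj _)) /=.
rewrite (eq_bigr (fun x : 'F_p => 'X + ((x : nat)%:R)%:P)); last first.
  by move=> x _; rewrite polyCN opprK natr_Zp.
rewrite -(big_mkord xpredT (fun j : nat => 'X + (j%:R)%:P)).
(* The index bound coming from the type ['F_p] equals [p] only propositionally, so it is generalized
   to [m]. *)
have E m : m = p -> \prod_(0 <= j < m) ('X + (j%:R)%:P) =
    'X * \prod_(1 <= j < p) ('X + (j%:R)%:P) :> {poly 'F_p}.
  by move=> ->; rewrite big_ltn ?prime_gt0 // addr0.
rewrite {}E ?Fp_cast // => <-.
by rewrite mulrBr mulr1 -exprS prednK // prime_gt0.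
Qed.

(** The coefficients of the discrepancy [D] vanish in ['F_p], so they can be divided by [p] one by
    one. *)
Lemma prod_XaddC_modp p : prime p -> exists q : {poly int},
  \prod_(1 <= j < p) ('X + (j%:Z)%:P) = 'X^(p.-1) - 1 + p%:Z%:P * q.
Proof.
move=> p_pr; set P := \prod_(_ <= _ < _) _.
pose D := P - ('X^(p.-1) - 1).
have D0 : map_poly (intr : int -> 'F_p) D = 0.
  rewrite /D rmorphB /= /P rmorph_prod rmorphB rmorph1 /= map_polyXn.
  rewrite -map_prod_XaddC_Fp //; apply/eqP; rewrite subr_eq0; apply/eqP.
  by apply: eq_bigr => j _; rewrite rmorphD /= map_polyX map_polyC.
have pD i : (p%:Z %| D`_i)%Z.
  by rewrite (dvdz_pcharf (pchar_Fp p_pr)) -coef_map D0 coef0.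
exists (\poly_(i < size D) (D`_i %/ p%:Z)%Z).
have -> : P = 'X^(p.-1) - 1 + D by rewrite /D addrC subrK.
congr (_ + _); apply/polyP => i; rewrite coefCM coef_poly.
case: ltnP => [_|/(nth_default _) -> //]; last by rewrite mulr0.
by rewrite mulrC divzK.
Qed.

(** * The factorial quotient extended to all integers *)

(* With the sign, Wilson's theorem makes every value congruent to 1 modulo [p]. *)
Definition shifted_fact (p : nat) (z : int) : rat :=
  - (\prod_(1 <= j < p) (z * p%:Z + j%:Z))%:~R.

(** The substitution of [p - j] for [j] negates each factor, and there are [p - 1] of them, an even
    number. *)
Lemma shifted_fact_sym p z : odd p -> shifted_fact p (- 1 - z) = shifted_fact p z.
Proof.
move=> p_odd; congr (- _%:~R); rewrite big_nat_rev /=.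
transitivity (\prod_(1 <= j < p) ((-1) * (z * p%:Z + j%:Z))).
  by apply: eq_big_nat => j /andP[_ jp]; rewrite add1n subSS -subzn 1?ltnW //; ring.
rewrite big_split /= prodr_const_nat -signr_odd.
by case: p p_odd => // p /= /negPf; rewrite subn1 => ->; rewrite mul1r.
Qed.

(** This is the function [W] of the introduction. The index [b.+1] appears because [Negz b] stands
    for [-(b + 1)]. *)
Definition quot_fact (p : nat) (z : int) : rat :=
  match z with
  | Posz b => \prod_(a < b) shifted_fact p a
  | Negz b => (\prod_(a < b.+1) shifted_fact p a)^-1
  end.

Lemma quot_factN p (b : nat) : quot_fact p (- b%:Z) = (quot_fact p b)^-1.
Proof. by case: b => [|b]; rewrite ?oppr0 /= ?big_ord0 ?invr1 // -NegzE. Qed.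

(** At [z = -(b + 1)] the ratio is [W(b + 1) / W(b) = F(b)], which the symmetry turns into
    [F(z)]. *)
Lemma mdiff_quot_fact p z : odd p -> (forall x, shifted_fact p x != 0) ->
  mdiff (quot_fact p) z = shifted_fact p z.
Proof.
move=> p_odd f0.
have W0 b : quot_fact p (Posz b) != 0 by rewrite /=; apply/prodf_neq0 => i _.
rewrite /mdiff; case: z => b.
  have -> : Posz b + 1 = b.+1 by rewrite -PoszD addn1.
  by have := W0 b; rewrite /= big_ord_recr /= => W0b; rewrite mulrAC divff // mul1r.
have -> : Negz b + 1 = - b%:Z by rewrite NegzE intS opprD addrAC addNr add0r.
rewrite quot_factN NegzE quot_factN invrK.
have -> : - b.+1%:Z = - 1 - b%:Z by rewrite intS opprD.
rewrite shifted_fact_sym //.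
by have := W0 b; rewrite /= big_ord_recr /= => W0b; rewrite mulrA mulVf // mul1r.
Qed.

Lemma factD m r : ((m + r)`! = m`! * \prod_(1 <= j < r.+1) (m + j))%N.
Proof.
elim: r => [|r IH]; first by rewrite addn0 big_geq // muln1.
by rewrite big_nat_recr //= mulnA -IH addnS factS mulnC.
Qed.

Lemma fact_mulE p b : (0 < p)%N ->
  ((b * p)`!)%:R = (- p%:R) ^+ b * (b`!)%:R * quot_fact p b.
Proof.
move=> p0; elim: b => [|b IH]; first by rewrite /= big_ord0 !mulr1.
(* The last factor [(b + 1) p] supplies the new [p] and the new factor of [b.+1!]; the sign in [- p]
   offsets the one in [shifted_fact]. *)
have E : ((b.+1 * p)`! = (b * p)`! * (\prod_(1 <= j < p) (b * p + j) * (b.+1 * p)))%N.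
  rewrite mulSnr factD; congr (_ * _)%N.
  by rewrite -{1}(prednK p0) big_nat_recr //= prednK.
rewrite E natrM IH natrM natrM factS exprS /= big_ord_recr /= /shifted_fact.
have -> : (\prod_(1 <= j < p) (b%:Z * p%:Z + j%:Z))%:~R
    = (\prod_(1 <= j < p) (b * p + j))%:R :> rat.
  rewrite rmorph_prod natr_prod; apply: eq_bigr => j _.
  by rewrite -PoszM -PoszD.
rewrite natrM; ring.
Qed.

(** * The [p]-adic estimate for weighted products *)

Lemma prime_dvd_fact p m : prime p -> (m < p)%N -> ~~ (p %| m`!)%N.
Proof.
move=> p_pr; elim: m => [|m IH] mp; first by rewrite fact0 dvdn1 neq_ltn prime_gt1 ?orbT.
by rewrite factS Euclid_dvdM // negb_or IH ?(ltnW mp) // andbT gtnNdvd.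
Qed.

(** The function is [-(p z)^(p-1) - p q(p z)]. The first term is divisible by [p^(m+1)] because
    [m + 1 <= p - 1]; the second is [p] times a flat function. *)
Lemma flat_shifted_fact p (p_pr : prime p) m : (m.+1 < p)%N ->
  flat (Zloc p_pr) p%:R m 1 (fun z => shifted_fact p z - 1).
Proof.
move=> mp; have p0 := prime_neq0_rat p_pr; have rad := @Zloc_rad _ p_pr.
have pV : p%:R \in Zloc p_pr by rewrite rpred_nat.
have [q qE] := prod_XaddC_modp p_pr.
have Vq : map_poly intr q \is a polyOver (Zloc p_pr).
  by apply/polyOverP => i; rewrite coef_map rpred_int.
have Hq : flat (Zloc p_pr) p%:R m 1 (fun z => - p%:R * (map_poly intr q).[p%:R * z%:~R]).
  apply: (flatM (i := 1)); last exact: flat_horner.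
  by apply: flat_cst; rewrite rpredN; apply/adicP => //; exists 1; rewrite ?rpred1 ?mulr1.
have Hx : flat (Zloc p_pr) p%:R m 1 (fun z => (z ^+ p.-1)%:~R * - p%:R ^+ p.-1).
  apply: flat_int => //; rewrite rpredN; apply: (@leq_adic _ _ _ p0 pV _ p.-1).
    by rewrite addn1 -ltnS prednK // prime_gt0.
  by apply/adicP => //; exists 1; rewrite ?rpred1 ?mulr1.
apply: eq_flat (flatD Hx Hq) => z; rewrite /shifted_fact.
have -> : \prod_(1 <= j < p) (z * p%:Z + j%:Z) =
    (\prod_(1 <= j < p) ('X + (j%:Z)%:P)).[z * p%:Z].
  by rewrite horner_prod; apply: eq_bigr => j _; rewrite !hornerE.
rewrite qE !hornerE !rmorphD /= rmorphN1 rmorphXn !rmorphM /=.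
have -> : (map_poly intr q).[p%:R * z%:~R] = (q.[z * p%:Z])%:~R :> rat.
  by rewrite -horner_map /= rmorphM /= mulrC.
by rewrite !rmorphXn /= intrM exprMn; ring.
Qed.

(** Only odd powers survive in [q(b) - q(-b)], and those of degree at most [2n] have exponent at
    most [2n - 1]. *)
Lemma sum_odd_poly (k n : nat) (b : 'I_k -> int) (ns : 'I_k -> int) (q : {poly int}) :
  (forall j : nat, (j < n)%N -> \sum_(i < k) ns i * b i ^+ (2 * j).+1 = 0) ->
  (size q <= (2 * n).+1)%N -> \sum_i ns i * (q.[b i] - q.[- b i]) = 0.
Proof.
move=> hsum sq.
transitivity (\sum_(j < (2 * n).+1) q`_j * \sum_i ns i * (b i ^+ j - (- b i) ^+ j)).
  under [RHS]eq_bigr do rewrite mulr_sumr.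
  rewrite exchange_big; apply: eq_bigr => i _.
  rewrite !(horner_coef_wide _ sq) -sumrB mulr_sumr.
  by apply: eq_bigr => j _; ring.
apply: big1 => j _.
have := odd_double_half j; case: (boolP (odd j)) => [oj|ej] jE; last first.
  rewrite big1 ?mulr0 // => i _.
  by rewrite exprNn -signr_odd (negPf ej) expr0 mul1r subrr mulr0.
have jn : (j./2 < n)%N by have := ltn_ord j; lia.
have -> : \sum_i ns i * (b i ^+ j - (- b i) ^+ j) = 2 * \sum_i ns i * b i ^+ (2 * j./2).+1.
  rewrite mulr_sumr; apply: eq_bigr => i _.
  have -> : (2 * j./2).+1 = j by lia.
  by rewrite exprNn -signr_odd oj; ring.
by rewrite hsum // !mulr0.
Qed.

Lemma prod_quot_fact_one_adic p (p_pr : prime p) (k n : nat) (b : 'I_k -> nat)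
    (ns : 'I_k -> int) :
  (2 < p)%N -> ((2 * n).+1 < p)%N ->
  (forall j : nat, (j < n)%N -> \sum_(i < k) ns i * (b i)%:Z ^+ (2 * j).+1 = 0) ->
  \prod_(i < k) quot_fact p (b i) ^ ns i \in one_adic (Zloc p_pr) p%:R (2 * n).+1.
Proof.
move=> p2 np hsum; set N := (2 * n).+1; set x := \prod_i _.
have p0 := prime_neq0_rat p_pr; have rad := @Zloc_rad _ p_pr.
have pV : p%:R \in Zloc p_pr by rewrite rpred_nat.
have p_odd : odd p by case: (even_prime p_pr) p2 => [->|].
have Hf m := @flat_shifted_fact p p_pr m.
have f1 z : shifted_fact p z \in one_adic (Zloc p_pr) p%:R 1.
  exact: (flat_adic (Hf 0 (prime_gt1 p_pr)) z).
have f0 z : shifted_fact p z != 0 := (adic1_unit p0 rad (f1 z)).1.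
have dc j := one_adic_divr_closed p0 pV rad j.
have W1 (a : nat) : quot_fact p a \in one_adic (Zloc p_pr) p%:R 1.
  by rewrite /=; apply: (divr_closed_prod (dc 0)) => i _.
have W0 z : quot_fact p z != 0.
  by case: z => a /=; rewrite ?invr_eq0; apply/prodf_neq0 => i _.
have HW z : iter N mdiff (quot_fact p) z \in one_adic (Zloc p_pr) p%:R N.
  (* The first multiplicative difference turns [W] into [F]; the remaining [2n] gain [2n] powers of
     [p]. *)
  rewrite iterSr (eq_iter_mdiff _ (fun z => mdiff_quot_fact z p_odd f0)).
  have := iter_mdiff_one_adic p0 pV rad (Hf (2 * n)%N np) z.
  by rewrite addn0.
(* Using the points [b_i] and [-b_i] with opposite weights annihilates even powers as well. Since
   [W(-b) = 1 / W(b)], this merely squares the product. *)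
pose zz (i : 'I_k + 'I_k) : int := match i with inl i => b i | inr i => - (b i)%:Z end.
pose ww (i : 'I_k + 'I_k) : int := match i with inl i => ns i | inr i => - ns i end.
have := prod_exprz_closed (dc (2 * n)%N) (z := zz) (w := ww) W0 HW.
set D := (\prod_(j < N) j`!)%N.
(* The total exponent, 2 from the doubling and [D] from the factorials of [j < N < p], is a [p]-adic
   unit and can be removed. *)
have pD : ~~ (p %| 2 * D)%N.
  rewrite Euclid_dvdM // negb_or gtnNdvd //=.
  apply: (big_ind (fun m => ~~ (p %| m)%N)) => [|u v pu pv|j _].
  - by rewrite dvdn1 neq_ltn prime_gt1 ?orbT.
  - by rewrite Euclid_dvdM // negb_or pu.
  - exact/prime_dvd_fact/(ltn_trans (ltn_ord j) np).
have -> : \prod_i quot_fact p (zz i) ^ ww i = x ^+ 2.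
  rewrite big_sumType /= expr2; congr (_ * _); apply: eq_bigr => i _.
  by rewrite quot_factN exprz_inv opprK.
rewrite -exprM => HD.
apply: (one_adicX_inj p0 pV rad (Zloc_natV p_pr pD)).
- by rewrite pnatr_eq0; apply: contraNneq pD => ->.
- by apply: (divr_closed_prod (dc 0)) => i _; apply: (divr_closed_expz (dc 0)).
apply: HD => q sq; rewrite big_sumType /= -[RHS](sum_odd_poly hsum sq) -big_split /=.
by apply: eq_bigr => i _; ring.
Qed.

(** * The congruence for factorials *)

Theorem mainTheorem13 (k : nat) (b : 'I_k -> nat) (ns : 'I_k -> int) (n : nat)
  (hn : (0 < n)%N)
  (hsum : forall j : nat, (j < n)%N ->
     \sum_(i < k) ns i * ((b i)%:Z) ^+ (2 * j).+1 = 0) :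
  exists P : nat, forall p : nat, prime p -> (P <= p)%N ->
    padic_congr p (2 * n).+1
      (\prod_(i < k) ((b i * p)`!)%:R ^ (ns i))
      (\prod_(i < k) ((b i)`!)%:R ^ (ns i)).
Proof.
(* The bound ensures both [2n + 1 < p], for the estimate on [W], and [b_i < p], which makes each
   [b_i!] a [p]-adic unit. *)
exists (2 * n + 2 + \sum_i b i)%N => p p_pr Pp.
have bp i : (b i < p)%N.
  by move: Pp; rewrite (bigD1 i) //=; lia.
have p0 := prime_neq0_rat p_pr.
have xy : (\prod_(i < k) quot_fact p (b i) ^ ns i) \in one_adic (Zloc p_pr) p%:R (2 * n).+1.
  by apply: prod_quot_fact_one_adic => //; lia.
set y := \prod_(i < k) ((b i)`!)%:R ^ ns i.
have yV : y \in Zloc p_pr.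
  apply: rpred_prod => i _; case: (ns i) => m; first by rewrite rpredX ?rpred_nat.
  by rewrite NegzE -invr_expz -exprVn rpredX // Zloc_natV // prime_dvd_fact.
have -> : \prod_(i < k) ((b i * p)`!)%:R ^ ns i = y * \prod_(i < k) quot_fact p (b i) ^ ns i.
  have pp : - p%:R != 0 :> rat by rewrite oppr_eq0.
  transitivity (\prod_(i < k) ((- p%:R) ^ ((b i)%:Z * ns i) *
      ((b i)`!%:R ^ ns i * quot_fact p (b i) ^ ns i)) : rat).
    apply: eq_bigr => i _.
    by rewrite fact_mulE ?prime_gt0 // !expfzMl exprnP exprz_exp mulrA.
  rewrite big_split -exprz_sumr //= big_split /= -/y.
  (* The powers of [-p] cancel by the first moment, the case [j = 0], available since [n] is
     positive. *)
  have -> : \sum_i (b i)%:Z * ns i = 0.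
    by rewrite -[RHS](hsum 0 hn); apply: eq_bigr => i _; rewrite mulrC.
  by rewrite mul1r.
rewrite /padic_congr.
have /adicP : y * \prod_(i < k) quot_fact p (b i) ^ ns i - y
    \in adic (Zloc p_pr) p%:R (2 * n).+1.
  by rewrite -[X in _ - X]mulr1 -mulrBr adicMl // rpred_nat.
case=> // r /ZlocP[u [v [pv ->]]] ->.
by exists u, v; rewrite natrX.
Qed.
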